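(* For a positive integer $d$ define $$h(d):=\limsup_{n\to\infty}\frac{e_d(n)}{n}.$$ If $d$ is odd, then $h(d)=0$. If $d$ is even, then $h(d)=2/d$.
   Context: For $n\geqslant 1$, $Q_n$ denotes the $n$-dimensional hypercube: its vertices are all binary sequences $x=(x_i)_{i=1,\dots,n}$, and it is equipped with the Hamming distance $\rho(x,y)=|\{i : x_i\neq y_i\}|$. For a positive integer $d$, a non-empty subset $S\subseteq Q_n$ is called $d$-equilateral if $\rho(x,y)=d$ for all distinct $x,y\in S$. $e_d(n)$ denotes the maximal cardinality of a $d$-equilateral subset of $Q_n$ (so $e_d(n)=1$ if $d>n$). *)

(* Defs.v *)
From HB Require Import structures.
From mathcomp Require Import all_boot all_order all_algebra.

Set Implicit Arguments.
Unset Strict Implicit.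
Unset Printing Implicit Defensive.

Notation hypercube n := {ffun 'I_n -> bool}.

Definition hamming (n : nat) (x y : hypercube n) : nat :=
  #|[set i | x i != y i]|.

Definition equilateral (d n : nat) (S : {set hypercube n}) : bool :=
  (S != set0) &&
  [forall x in S, forall y in S, (x != y) ==> (hamming x y == d)].

Definition max_equilateral (d n : nat) : nat :=
  \max_(S : {set hypercube n} | equilateral d S) #|S|.

From mathcomp Require Import all_classical all_reals all_analysis.
Import Order.TTheory GRing.Theory Num.Theory.

Local Open Scope ring_scope.

(* The limsup is taken in the extended reals, so it carries no convergence or
   boundedness side condition; the term at n = 0 has no influence on it. *)
Definition equilateral_density (R : realType) (d : nat) : \bar R :=
  limn_esup (fun n : nat => ((max_equilateral d n)%:R / n%:R : R)%:E).

(* Main.v *)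
(* Fix [x0] in an equilateral set [S] and replace each other word by its set of
   differences with [x0]: these are [d]-sets any two of which share [d / 2]
   points.  If [d] is odd there is thus no room for two of them.  If [d = 2k]
   and there are many of them, pigeonhole on the traces left on one of them
   yields more than [2k] sets having the same trace [K], [#|K| = k]; these form
   a sunflower with kernel [K].  A member not containing [K] would meet all the
   (disjoint) petals, which it is too small to do, so the whole family is a
   sunflower with disjoint petals of size [k], and [k * #|S|] is at most [n]
   up to a constant.  Indicators of disjoint blocks of length [k] show that
   this is sharp. *)
Require Import Defs.
From mathcomp Require Import all_boot all_order all_algebra.
From mathcomp Require Import all_classical all_reals all_analysis.
(* [all_classical] shadows names of [fintype] and [finset]. *)
From mathcomp Require Import fintype finset zify ring lra.

Set Implicit Arguments.
Unset Strict Implicit.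
Unset Printing Implicit Defensive.

Import Order.TTheory GRing.Theory Num.Theory.

(** * Sunflowers in families of finite sets *)

Section Sunflower.
Local Open Scope nat_scope.
Variable T : finType.
Implicit Types (A B K : {set T}) (F G : {set {set T}}).

(** The petals [A :\: K] are pairwise disjoint, and [K \subset A] lets [A] be recovered from its
    petal, so no petal is counted twice. *)
Lemma card_petals_leq K k F :
  {in F, forall A, K \subset A /\ k <= #|A :\: K|} ->
  {in F &, forall A B, A != B -> A :&: B \subset K} ->
  #|F| * k <= #|T|.
Proof.
move=> FK disjF.
pose P := [set A :\: K | A in F].
have Pinj : {in F &, injective (fun A => A :\: K)}.
  move=> A B /FK[/setIidPr KA _] /FK[/setIidPr KB _] /= eAB.
  by rewrite -(setID A K) -(setID B K) eAB KA KB.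
have trivP : trivIset P.
  apply/trivIsetP => _ _ /imsetP[A FA ->] /imsetP[B FB ->] neq.
  have neAB : A != B by apply: contraNneq neq => ->.
  rewrite -setI_eq0 -setDIl setD_eq0; exact: disjF.
apply: leq_trans (max_card (mem (cover P))).
rewrite -(eqP trivP) big_imset //= -sum_nat_const.
by apply: leq_sum => A /FK[].
Qed.

Lemma sunflower_kernel_subset K k F G B :
  (forall A, A \in G -> A \in F /\ K \subset A) ->
  {in G &, forall A A', A != A' -> A :&: A' \subset K} ->
  #|K| = k -> {in F &, forall A A', A != A' -> #|A :&: A'| = k} ->
  B \in F -> #|B| < #|G| -> K \subset B.
Proof.
move=> GF sunG cK interF FB; apply: contraLR => nKB; rewrite -leqNgt.
have ltBK : #|B :&: K| < k.
  rewrite -cK; apply: proper_card; rewrite properE subsetIr.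
  by rewrite subsetI (negbTE nKB).
(* Of the [k] points of [A :&: B], fewer than [k] lie in [K]. *)
have meet A : A \in G -> exists x, x \in (A :\: K) :&: B.
  move=> GA; have [FA KA] := GF _ GA.
  have neAB : A != B by apply: contraNneq nKB => <-.
  apply/set0Pn; rewrite -card_gt0.
  have := cardsID K (A :&: B); rewrite (interF A B) //.
  have : #|A :&: B :&: K| <= #|B :&: K|.
    by apply: subset_leq_card; rewrite -setIA subsetIr.
  rewrite setIDAC; lia.
have [/eqP ->|/set0Pn[A0 /meet[x0 _]]] := boolP (G == set0).
  by rewrite cards0.
(* [f] picks a point of [B] in each petal ([x0] is a mere default). As the petals are disjoint, [f]
   is injective on [G], whence [#|G| <= #|B|]. *)
pose f A := odflt x0 [pick x in (A :\: K) :&: B].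
have fP A : A \in G -> f A \in (A :\: K) :&: B.
  move=> /meet[x xA]; rewrite /f; case: pickP => [y //|/(_ x)].
  by rewrite xA.
rewrite -(card_in_imset (f := f)) => [|A A' GA GA' eqf].
  apply/subset_leq_card/subsetP => _ /imsetP[A /fP + ->].
  by rewrite inE => /andP[].
apply: contraTeq (fP _ GA) => neAA'.
have := fP _ GA'; rewrite -eqf !inE => /andP[/andP[nK fA'] _].
apply: contraNN nK => /andP[/andP[_ fA] _].
by apply: (subsetP (sunG _ _ GA GA' neAA')); rewrite inE fA.
Qed.

Lemma pigeonhole_fiber (rT : finType) (X : {set T}) (f : T -> rT)
    (Y : {set rT}) m :
  {in X, forall x, f x \in Y} -> #|Y| * m < #|X| ->
  exists2 y, y \in Y & m < #|[set x in X | f x == y]|.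
Proof.
move=> fXY lt; apply/exists_inP; apply: contraLR lt.
rewrite negb_exists_in -leqNgt => /forall_inP small.
rewrite -sum_nat_const -sum1_card (partition_big f (mem Y)) //=.
apply: leq_sum => y /small; rewrite -leqNgt; apply: leq_trans.
by rewrite sum1_card subset_leq_card //; apply/subsetP => x; rewrite !inE.
Qed.
End Sunflower.

Lemma card_equiintersecting_leq (T : finType) k (F : {set {set T}}) :
  {in F, forall A : {set T}, #|A| = k.*2} ->
  {in F &, forall A B : {set T}, A != B -> #|A :&: B| = k} ->
  (2 ^ k.*2 * k.*2).+1 < #|F| -> #|F| * k <= #|T|.
Proof.
move=> cF interF bigF.
have [F0|[A FA]] := set_0Vmem F; first by rewrite F0 cards0.
(* There are [2 ^ k.*2] possible traces on [A]; the successor in the hypothesis pays for removing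
   [A]. More than [k.*2] sets per trace is what beats [#|B|] in [sunflower_kernel_subset]. *)
have [||K _ bigG] := @pigeonhole_fiber _ _ (F :\ A) (fun B => A :&: B)
    (powerset A) k.*2.
- by move=> B _; rewrite inE subsetIl.
- move: bigF; rewrite card_powerset cF // (cardsD1 A F) FA; lia.
set G := [set B in F :\ A | _] in bigG.
have GF B : B \in G -> [/\ B \in F, A != B & A :&: B = K].
  by rewrite !inE eq_sym => /andP[/andP[-> ->] /eqP ->].
have cK : #|K| = k.
  have /set0Pn[B /GF[FB neAB <-]] : G != set0 by rewrite -card_gt0; lia.
  exact: interF.
have GK B : B \in G -> B \in F /\ K \subset B.
  by move=> /GF[-> _ <-]; rewrite subsetIr.
(* Such an intersection contains [K] and has the same size [k], so it equals [K]. *)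
have interK : {in F &, forall B B' : {set T}, B != B' ->
    K \subset B -> K \subset B' -> B :&: B' \subset K}.
  move=> B B' FB FB' neq KB KB'.
  have /eqP <- : K == B :&: B'; last by [].
  by rewrite eqEcard subsetI KB KB' interF // cK leqnn.
have FK B : B \in F -> K \subset B.
  move=> FB; apply: (sunflower_kernel_subset GK _ cK interF FB).
    by move=> C C' /GK[FC KC] /GK[FC' KC'] neq; exact: interK.
  by rewrite cF.
apply: (@card_petals_leq _ K) => [B FB|B B' FB FB' neq].
  split; first exact: FK.
  by rewrite cardsD (setIidPr (FK _ FB)) cF // cK; lia.
by apply: interK => //; exact: FK.
Qed.

(** * Bounds on equilateral sets in the hypercube *)

Section Hypercube.
Local Open Scope nat_scope.
Variable n : nat.
Implicit Types (x y z : hypercube n) (S : {set hypercube n}).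

Definition differences x y : {set 'I_n} := [set i | x i != y i].

Lemma differences_inj x : injective (differences x).
Proof.
move=> y z /setP eq; apply/ffunP => i; have := eq i; rewrite !inE.
by case: (x i) (y i) (z i) => [] [] [].
Qed.

(** The words [y] and [z] differ exactly on the symmetric difference of [differences x y] and
    [differences x z]. *)
Lemma hamming_differences x y z :
  hamming y z + (#|differences x y :&: differences x z|).*2
  = hamming x y + hamming x z.
Proof.
rewrite /hamming -/(differences x y) -/(differences x z).
rewrite -(cardsID (differences x z) (differences x y)).
rewrite -(cardsID (differences x y) (differences x z)).
rewrite -(cardsID (differences x y) [set i | _]) (setIC (differences x z)).
have -> : [set i | y i != z i] :&: differences x y
          = differences x y :\: differences x z.
  by apply/setP => i; rewrite !inE; case: (x i) (y i) (z i) => [] [] [].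
have -> : [set i | y i != z i] :\: differences x y
          = differences x z :\: differences x y.
  by apply/setP => i; rewrite !inE; case: (x i) (y i) (z i) => [] [] [].
lia.
Qed.

Lemma equilateralP d S :
  reflect (S != set0 /\ {in S &, forall x y, x != y -> hamming x y = d})
          (equilateral d S).
Proof.
apply: (iffP andP) => -[S0 eqS]; split=> //.
  move=> x y Sx Sy neq.
  by move/forall_inP/(_ _ Sx)/forall_inP/(_ _ Sy)/implyP/(_ neq)/eqP: eqS.
apply/forall_inP => x Sx; apply/forall_inP => y Sy; apply/implyP => neq.
exact/eqP/eqS.
Qed.

Lemma card_differences_equilateral d S x y z : equilateral d S ->
  x \in S -> y \in S -> z \in S -> x != y -> x != z -> y != z ->
  (#|differences x y :&: differences x z|).*2 = d.
Proof.
move=> /equilateralP[_ eqS] Sx Sy Sz xy xz yz.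
have := hamming_differences x y z; rewrite !eqS //; lia.
Qed.

Lemma card_odd_equilateral d S : odd d -> equilateral d S -> #|S| <= 2.
Proof.
move=> odd_d eqS; rewrite leqNgt; apply: contraL odd_d => /card_gt2P.
move=> [x [y [z [[Sx Sy Sz] [xy yz zx]]]]].
rewrite -(card_differences_equilateral eqS Sx Sy Sz) ?odd_double //.
by rewrite eq_sym.
Qed.

Lemma card_even_equilateral k S : 0 < k -> equilateral k.*2 S ->
  #|S| * k <= n + k * (2 ^ k.*2 * k.*2 + 2).
Proof.
move=> k0 eqS; have /equilateralP[/set0Pn[x Sx] eqd] := eqS.
pose F := differences x @: (S :\ x).
have cF : #|S| = #|F|.+1.
  by rewrite (cardsD1 x) Sx card_imset //; exact: differences_inj.
(* A small family is absorbed by the additive constant, whose [2] counts [x] and the successor in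
   the threshold. *)
have [bigF|smallF] := ltnP (2 ^ k.*2 * k.*2).+1 #|F|; last by rewrite cF; nia.
suff : #|F| * k <= #|{: 'I_n}| by rewrite card_ord cF; nia.
apply: card_equiintersecting_leq bigF.
  by move=> _ /imsetP[y /setD1P[yx Sy] ->]; apply: eqd; rewrite // eq_sym.
move=> _ _ /imsetP[y /setD1P[yx Sy] ->] /imsetP[z /setD1P[zx Sz] ->] neq.
apply: double_inj; apply: card_differences_equilateral eqS _ _ _ _ _ _ => //.
- by rewrite eq_sym.
- by rewrite eq_sym.
- by apply: contraNneq neq => ->.
Qed.

(** The condition on [j] excludes the last, possibly truncated, block. *)
Lemma card_block k j : j < n %/ k ->
  #|[set i : 'I_n | i %/ k == j]| = k.
Proof.
move=> jlt; have [k0|k0] := posnP k; first by rewrite k0 divn0 in jlt.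
have lt (r : 'I_k) : j * k + r < n.
  have := leq_trunc_div n k; have := ltn_ord r; nia.
rewrite -[RHS]card_ord -(card_imset (f := fun r => Ordinal (lt r))) => [|r s].
  apply: eq_card => i; rewrite !inE; apply/eqP/imsetP => [eqj|[r _ ->] /=].
    exists (Ordinal (ltn_pmod i k0)) => //; apply: val_inj => /=.
    by rewrite -eqj -divn_eq.
  by rewrite divnMDl // divn_small ?addn0.
by move/(congr1 val)/addnI/val_inj.
Qed.

Lemma max_equilateral_geq k : 0 < k -> n %/ k <= max_equilateral k.*2 n.
Proof.
move=> k0.
pose block j : hypercube n := [ffun i : 'I_n => i %/ k == j].
have dist (i j : 'I_(n %/ k)) : i != j -> hamming (block i) (block j) = k.*2.
  move=> ij; rewrite -addnn.
  rewrite -[in X in X + _](card_block (ltn_ord i)).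
  rewrite -[in X in _ + X](card_block (ltn_ord j)) -cardsUI /hamming.
  rewrite (_ : _ :&: _ = set0) ?cards0 ?addn0.
    apply: eq_card => l; rewrite !inE !ffunE.
    case: (l %/ k =P i) => [->|_]; last by case: (l %/ k == j).
    by rewrite -val_eqE in ij; rewrite (negbTE ij).
  apply/setP => l; rewrite !inE; apply: contraNF ij => /andP[/eqP li /eqP lj].
  by apply/eqP/val_inj; rewrite /= -li.
have block_inj : injective (fun i : 'I_(n %/ k) => block i).
  (* Equal indicators are at distance 0, not [k.*2]. *)
  move=> i j e; apply: contraTeq (k0) => /dist; rewrite e /hamming.
  rewrite (_ : [set _ | _] = set0) ?cards0; first by lia.
  by apply/setP => l; rewrite !inE eqxx.
(* Without a complete block the family would be empty, hence not equilateral, but the bound is then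
   trivial. *)
have [->//|m0] := posnP (n %/ k).
rewrite -[leqLHS]card_ord -(card_imset _ block_inj).
apply: (leq_bigmax_cond (F := fun S : {set hypercube n} => #|S|)).
apply/equilateralP; split.
  by apply/set0Pn; exists (block (Ordinal m0)); apply: imset_f.
move=> _ _ /imsetP[i _ ->] /imsetP[j _ ->] neq; apply: dist.
by apply: contraNneq neq => ->.
Qed.
End Hypercube.

(** * Passage to the limit *)

Local Open Scope ring_scope.

(** Dividing by [n] turns the bounded error into one of size at most [C / n], so the ratio converges
    and its upper limit is the limit. *)
Lemma limn_esup_ratio (R : realType) (u : nat -> nat) (c C : R) :
  (forall n, `|(u n)%:R - c * n%:R| <= C) ->
  limn_esup (fun n => ((u n)%:R / n%:R : R)%:E) = c%:E.
Proof.
move=> bound.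
suff cv : ((fun n => ((u n)%:R / n%:R : R)%:E) @ \oo --> c%:E)%classic.
  by rewrite is_cvg_limn_esupE ?(cvg_lim _ cv) //; apply/cvg_ex; exists c%:E.
apply/fine_cvgP; split; first by near=> n.
apply/cvgrPdist_le => e e0; near=> n.
have n0 : (0 : R) < n%:R by rewrite ltr0n; near: n; exact: nbhs_infty_gt.
rewrite /= distrC -[X in _ - X](mulfK (lt0r_neq0 n0)) -mulrBl normrM normfV.
rewrite (gtr0_norm n0) ler_pdivrMr //.
apply: le_trans (bound _) _; rewrite mulrC -ler_pdivrMr //.
near: n; exact: nbhs_infty_ger.
Unshelve. all: by end_near. Qed.

Theorem theorem4p1 (R : realType) (d : nat) (d_gt0 : (0 < d)%N) :
  (odd d -> equilateral_density R d = 0%:E) /\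
  (~~ odd d -> equilateral_density R d = (2%:R / d%:R)%:E).
Proof.
split=> [odd_d|even_d].
  apply: (@limn_esup_ratio _ _ _ 2%:R) => n.
  rewrite mul0r subr0 normr_nat ler_nat.
  by apply/bigmax_leqP => S; apply: card_odd_equilateral.
have [k k0 ->] : exists2 k, (0 < k)%N & d = k.*2.
  exists d./2; last by rewrite even_halfK.
  by rewrite half_gt0; case: d d_gt0 even_d => [|[]].
pose M := (2 ^ k.*2 * k.*2 + 2)%N.
have upper n : (max_equilateral k.*2 n * k <= n + k * M)%N.
  rewrite -leq_divRL //; apply/bigmax_leqP => S eqS.
  by rewrite leq_divRL //; apply: card_even_equilateral.
(* The blocks miss fewer than [k] coordinates, and [k <= k * M]. *)
have lower n : (n <= max_equilateral k.*2 n * k + k * M)%N.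
  have := max_equilateral_geq n k0; have := ltn_ceil n k0; rewrite /M; nia.
clearbody M.
have kR : (0 : R) < k%:R by rewrite ltr0n.
apply: (@limn_esup_ratio _ _ _ M%:R) => n.
(* Since [2 / d = 1 / k], scaling by [k] reduces the bound to [upper] and [lower]. *)
rewrite -(ler_pM2l kR) -{1}(gtr0_norm kR) -normrM.
rewrite (_ : k%:R * _ = (max_equilateral k.*2 n * k)%:R - n%:R); last first.
  by rewrite natrM -muln2 natrM; field; rewrite gt_eqF.
move: (upper n) (lower n); rewrite -!(ler_nat R) !natrD !natrM.
by rewrite ler_norml => ? ?; apply/andP; split; lra.
Qed.
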